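(* (i) Suppose there is a function $f:\prod_{X:\mathcal{U}}X\to X$ that is natural under equivalence, a type $X:\mathcal{U}$ and an isolated point $x:X$ with $f_X(x)\neq x$. Then the law of excluded middle holds. (ii) Assuming function extensionality, conversely, if the law of excluded middle holds then there exist a function $f:\prod_{X:\mathcal{U}}X\to X$ natural under equivalence, a type $X:\mathcal{U}$ and an isolated point $x:X$ with $f_X(x)\neq x$.
   Context: Work in intensional Martin-Löf type theory with $\Pi$-, $\Sigma$-, identity, finite types and natural numbers, and a universe $\mathcal{U}$ closed under these. $=$ denotes the identity type, $\neg A$ means $A\to\mathbf{0}$, $a\neq b$ means $\neg(a=b)$, $f_X$ abbreviates $f(X)$. A type is a proposition if any two of its elements are equal. The law of excluded middle: for every proposition $P:\mathcal{U}$, $P+\neg P$. An equivalence is a map with a left and a right inverse. $f:\prod_{X:\mathcal{U}}X\to X$ is natural under equivalence if $e(f_X(x))=f_Y(e(x))$ for all $X,Y:\mathcal{U}$, equivalences $e:X\to Y$ and $x:X$. A point $x:X$ is isolated if $\prod_{y:X}(x=y)+(x\neq y)$. *)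

(* Defs.v *)
(* Everything lives in the predicative Type hierarchy, with no use of Prop.  The
   Prelude supplies Sigma (sigT), binary products (prod), coproducts (sum) and
   the empty type (Empty_set). *)

Set Implicit Arguments.
Unset Strict Implicit.
Unset Printing Implicit Defensive.

(* One fixed universe: all occurrences of U denote the same Type@{u}. *)
Definition U := Type.

(* The Martin-Loef identity type, valued in U rather than in Prop as eq is. *)
Inductive Id (A : U) (a : A) : A -> U :=
  Id_refl : Id a a.
Arguments Id_refl {A a}.

Definition Neg (A : U) : U := A -> Empty_set.

Definition IsProp (P : U) : U := forall p q : P, Id p q.

Definition LEM := forall P : U, IsProp P -> P + Neg P.

(* Pointwise equality implies equality, for dependent functions between types
   of U. This is implied by the form stating that the canonical map from
   equality to pointwise equality is an equivalence. *)
Definition FunExt :=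
  forall (A : U) (B : A -> U) (g h : forall a : A, B a),
    (forall a : A, Id (g a) (h a)) -> Id g h.

Definition IsEquiv (X Y : U) (e : X -> Y) : U :=
  ({l : Y -> X & forall x : X, Id (l (e x)) x} *
   {r : Y -> X & forall y : Y, Id (e (r y)) y})%type.

Definition NaturalUnderEquiv (f : forall X : U, X -> X) :=
  forall (X Y : U) (e : X -> Y), IsEquiv e ->
    forall x : X, Id (e (f X x)) (f Y (e x)).

Definition Isolated (X : U) (x : X) : U :=
  forall y : X, (Id x y + Neg (Id x y))%type.

(* Main.v *)
(** (i) Given a proposition [P], shrink [X = 1 + X'] to [Z = 1 + P * X'], where
    [X'] is the complement of the isolated point [x], and apply [f] to the added
    point of [Z].  If the value lies in [P * X'], then [P] holds; if it is the
    added point, then [P] fails, since [P] would give an equivalence [Z = X]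
    carrying the added point to [x], and naturality would force [f X x = x].

    (ii) Let [f X x] be the unique point of [X] different from [x] if the type of
    such points is contractible, and [x] otherwise.  It moves both booleans. *)

Require Import Defs.

Set Implicit Arguments.
Unset Strict Implicit.
Unset Printing Implicit Defensive.

Definition Id_sym (A : U) (a b : A) (p : Id a b) : Id b a :=
  match p in Id _ c return Id c a with Id_refl => Id_refl end.

Definition Id_trans (A : U) (a b c : A) (p : Id a b) (q : Id b c) : Id a c :=
  match q in Id _ d return Id a d with Id_refl => p end.

Definition Id_ap (A B : U) (g : A -> B) (a b : A) (p : Id a b) :
    Id (g a) (g b) :=
  match p in Id _ c return Id (g a) (g c) with Id_refl => Id_refl end.

Lemma Id_sig (A : U) (B : A -> U) (hB : forall a, IsProp (B a))
    (s t : {a : A & B a}) : Id (projT1 s) (projT1 t) -> Id s t.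
Proof.
  destruct s as [a b], t as [a' b']; simpl; intros p; destruct p.
  destruct (hB a b b'); exact Id_refl.
Defined.

Section ExcludedMiddleFromIsolatedPoint.

Variables (X : U) (x : X) (d : Isolated x) (P : U).

(* A truth-value version of [Neg (Id x y)]: that [Neg _] is a proposition would
   require function extensionality. *)
Definition Apart (y : X) : U :=
  if d y then Empty_set else unit.

Lemma Apart_isProp (y : X) : IsProp (Apart y).
Proof.
  unfold Apart; destruct (d y); intros u v.
  - destruct u.
  - destruct u, v; exact Id_refl.
Qed.

Lemma Apart_irrefl : Neg (Apart x).
Proof.
  unfold Apart; intros u; destruct (d x) as [p | n].
  - exact u.
  - exact (n Id_refl).
Qed.

Lemma Id_or_Apart (y : X) : Id x y + Apart y.
Proof.
  unfold Apart; destruct (d y) as [p | n].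
  - exact (inl p).
  - exact (inr tt).
Qed.

Definition Shrunk : U := option (P * {y : X & Apart y}).

Definition unshrink (z : Shrunk) : X :=
  match z with
  | None => x
  | Some (_, s) => projT1 s
  end.

(** An inhabited proposition [P] is a unit factor, and isolation decides whether a point of [X] is
    [x] or lies in the complement. *)
Lemma unshrink_isEquiv : IsProp P -> P -> IsEquiv unshrink.
Proof.
  intros hP p.
  pose (g := fun y => match Id_or_Apart y with
                      | inl _ => None
                      | inr u => Some (p, existT Apart y u)
                      end : Shrunk).
  split; exists g; unfold g.
  - intros [[p' [y u]] |]; simpl.
    + destruct (Id_or_Apart y) as [q | u'].
      * destruct q; destruct (Apart_irrefl u).
      * destruct (hP p p'), (Apart_isProp u u'); exact Id_refl.
    + destruct (Id_or_Apart x) as [q | u].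
      * exact Id_refl.
      * destruct (Apart_irrefl u).
  - intros y; destruct (Id_or_Apart y) as [q | u]; simpl.
    + exact q.
    + exact Id_refl.
Qed.

End ExcludedMiddleFromIsolatedPoint.

Lemma LEM_of_moved_isolated_point (f : forall X : U, X -> X)
    (nf : NaturalUnderEquiv f) (X : U) (x : X) (d : Isolated x) :
  Neg (Id (f X x) x) -> LEM.
Proof.
  intros hx P hP.
  (* [unshrink] sends [None] to [x], so if [f] fixes [None], this reads: every [p : P] yields
     [Id x (f X x)]. *)
  pose proof (fun p : P => nf _ _ _ (unshrink_isEquiv d hP p) None) as nat.
  destruct (f (Shrunk d P) None) as [[p s] |].
  - exact (inl p).
  - right; intros p; exact (hx (Id_sym (nat p))).
Qed.

Definition IsContr (A : U) : U := {c : A & forall a : A, Id c a}.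

(** By path induction, every path from [a] to [b] equals the composite through the center [c]. *)
Lemma IsProp_Id_of_center (A : U) (c : A) (h : forall a : A, Id c a) (a b : A) :
  IsProp (Id a b).
Proof.
  assert (canon : forall p : Id a b, Id (Id_trans (Id_sym (h a)) (h b)) p).
  { intros p; destruct p; destruct (h a); exact Id_refl. }
  intros p q; exact (Id_trans (Id_sym (canon p)) (canon q)).
Qed.

Lemma IsProp_Neg (fe : FunExt) (A : U) : IsProp (Neg A).
Proof.
  intros m n; apply fe; intros a; destruct (m a).
Qed.

(** This is what allows excluded middle to decide contractibility in [unique_other]. *)
Lemma IsProp_IsContr (fe : FunExt) (A : U) : IsProp (IsContr A).
Proof.
  intros [c h] t; apply Id_sig.
  - intros a m n; apply fe; intros b; apply (IsProp_Id_of_center h).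
  - exact (h (projT1 t)).
Qed.

Definition Others (X : U) (x : X) : U := {y : X & Neg (Id x y)}.

Section OthersEquiv.

Variables (fe : FunExt) (X Y : U) (e : X -> Y) (he : IsEquiv e) (x : X).

Lemma equiv_injective (a b : X) : Id (e a) (e b) -> Id a b.
Proof.
  destruct he as [[l hl] _]; intros p.
  exact (Id_trans (Id_sym (hl a)) (Id_trans (Id_ap l p) (hl b))).
Qed.

Definition Others_map (s : Others x) : Others (e x) :=
  existT (fun y => Neg (Id (e x) y)) (e (projT1 s))
    (fun p => projT2 s (equiv_injective p)).

(** Surjectivity here and injectivity of [e] suffice to transfer contractibility both ways, without
    inverting [Others_map]. *)
Lemma Others_map_surjective (t : Others (e x)) :
  {s : Others x & Id (Others_map s) t}.
Proof.
  destruct he as [_ [r hr]], t as [y n].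
  exists (existT (fun z => Neg (Id x z)) (r y)
            (fun p => n (Id_trans (Id_ap e p) (hr y)))).
  apply Id_sig.
  - intros a; apply (IsProp_Neg fe).
  - exact (hr y).
Qed.

Lemma IsContr_Others_map : IsContr (Others x) -> IsContr (Others (e x)).
Proof.
  intros [c h]; exists (Others_map c); intros t.
  destruct (Others_map_surjective t) as [s p].
  exact (Id_trans (Id_ap Others_map (h s)) p).
Qed.

Lemma IsContr_Others_map_inv : IsContr (Others (e x)) -> IsContr (Others x).
Proof.
  intros [c h]; destruct (Others_map_surjective c) as [s p].
  exists s; intros s'; apply Id_sig.
  - intros a; apply (IsProp_Neg fe).
  (* The images of [s] and [s'] both equal the center [c]. *)
  - apply equiv_injective.
    exact (Id_ap (@projT1 _ _) (Id_trans p (h (Others_map s')))).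
Qed.

End OthersEquiv.

Section UniqueOther.

Variables (fe : FunExt) (lem : LEM).

Definition unique_other (X : U) (x : X) : X :=
  match lem (IsProp_IsContr fe (A := Others x)) with
  | inl c => projT1 (projT1 c)
  | inr _ => x
  end.

(** Transfer of contractibility excludes the mixed cases. If both types are contractible, [e]
    carries the other point of [X] to a point distinct from [e x], hence to the center. *)
Lemma unique_other_natural : NaturalUnderEquiv unique_other.
Proof.
  intros X Y e he x; unfold unique_other.
  destruct (lem (IsProp_IsContr fe (A := Others x))) as [c | n];
  destruct (lem (IsProp_IsContr fe (A := Others (e x)))) as [c' | n'].
  - exact (Id_ap (@projT1 _ _)
             (Id_sym (projT2 c' (Others_map he (projT1 c))))).
  - destruct (n' (IsContr_Others_map fe he c)).
  - destruct (n (IsContr_Others_map_inv fe he c')).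
  - exact Id_refl.
Qed.

Lemma true_neq_false : Neg (Id true false).
Proof.
  intros p.
  exact (match p in Id _ b return if b then unit else Empty_set with
         | Id_refl => tt
         end).
Qed.

Lemma Isolated_true : Isolated true.
Proof.
  intros [|].
  - exact (inl Id_refl).
  - exact (inr true_neq_false).
Qed.

Lemma IsContr_Others_true : IsContr (Others true).
Proof.
  exists (existT (fun b => Neg (Id true b)) false true_neq_false).
  intros [[|] n].
  - destruct (n Id_refl).
  - apply Id_sig.
    + intros a; apply (IsProp_Neg fe).
    + exact Id_refl.
Qed.

Lemma unique_other_true : Neg (Id (unique_other true) true).
Proof.
  unfold unique_other.
  destruct (lem (IsProp_IsContr fe (A := Others true))) as [c | n]; intros p.
  (* Whatever center was chosen, it carries a proof of being distinct from [true]. *)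
  - exact (projT2 (projT1 c) (Id_sym p)).
  - exact (n IsContr_Others_true).
Qed.

End UniqueOther.

Theorem theorem2p4 :
  (forall f : (forall X : U, X -> X), NaturalUnderEquiv f ->
     forall (X : U) (x : X), Isolated x -> Neg (Id (f X x) x) ->
       LEM)
  *
  (FunExt -> LEM ->
     {f : forall X : U, X -> X &
       NaturalUnderEquiv f *
       {X : U & {x : X & Isolated x * Neg (Id (f X x) x)}}}).
Proof.
  split.
  - exact LEM_of_moved_isolated_point.
  - intros fe lem; exists (unique_other fe lem); split.
    + exact (unique_other_natural fe lem).
    + exists bool, true; split.
      * exact Isolated_true.
      * exact (@unique_other_true fe lem).
Qed.
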